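(* Let $A\in\mathbb{C}^{I\times J}$ be an $\mathcal{H}$-matrix and let $A^{\mathcal{UH}}$ be its uniform $\mathcal{H}$-matrix approximation computed by the uniform compression algorithm (described in the context), with orthogonal cluster bases $\{U_\tau\}_{\tau\in\mathcal{L}'_I}$ and $\{V_\sigma\}_{\sigma\in\mathcal{L}'_J}$. Then the global and local errors in the spectral norm satisfy $$\|A-A^{\mathcal{UH}}\|_2\le\sqrt2\,\sqrt{\sum_{\tau\in\mathcal{L}'_I}\|A_\tau-U_\tau U_\tau^*A_\tau\|_2^2+\sum_{\sigma\in\mathcal{L}'_J}\|A^*_\sigma-V_\sigma V_\sigma^*A^*_\sigma\|_2^2}\,.$$ Suppose moreover that, for some $\epsilon>0$, the local errors are scaled according to $$\|A_\tau-U_\tau U_\tau^*A_\tau\|_2=\frac{\epsilon}{2}\sqrt{\frac{|\tau|\cdot|\mathcal{F}(\tau)|}{|I|\cdot|J|}}\quad\text{and}\quad\|A^*_\sigma-V_\sigma V_\sigma^*A^*_\sigma\|_2=\frac{\epsilon}{2}\sqrt{\frac{|\sigma|\cdot|\mathcal{F}(\sigma)|}{|I|\cdot|J|}}$$ for all $\tau\in\mathcal{L}'_I$, $\sigma\in\mathcal{L}'_J$. Then the global error satisfies $$\|A-A^{\mathcal{UH}}\|_2\le\epsilon.$$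
   Context: **Cluster tree.** A cluster tree $\mathcal{T}_I$ for a finite index set $I$ is a finite tree whose nodes (clusters) are subsets of $I$, with root $I$, such that for each non-leaf node $\tau$ its set of children $s(\tau)$ is a partition of $\tau$ into pairwise disjoint subsets. **Block cluster tree.** Given cluster trees $\mathcal{T}_I,\mathcal{T}_J$, a block cluster tree $\mathcal{T}_{I\times J}$ is a cluster tree for $I\times J$ in which every node (block) has the form $b=\tau\times\sigma$ with $\tau\in\mathcal{T}_I$, $\sigma\in\mathcal{T}_J$, and for each non-leaf $b=\tau\times\sigma$ one has $s(b)=s(\tau)\times s(\sigma)$, $\{\tau\}\times s(\sigma)$ or $s(\tau)\times\{\sigma\}$. Its leaves form a partition $P_{I\times J}$ of $I\times J$, divided into admissible leaves $P^+_{I\times J}$ and inadmissible (dense) leaves $P^-_{I\times J}$. $A|_b\in\mathbb{C}^{\tau\times\sigma}$ denotes the submatrix of $A$ for $b=\tau\times\sigma$. **$\mathcal{H}$-matrix.** $A$ is an $\mathcal{H}$-matrix if for each $b=\tau\times\sigma\in P^+_{I\times J}$ it has a factorization $A|_b=X_bY_b^*$ with $X_b\in\mathbb{C}^{\tau\times k_b}$, $Y_b\in\mathbb{C}^{\sigma\times k_b}$. **Clusters and far fields.** $\mathcal{L}'_I=\{\tau\in\mathcal{T}_I:\exists\sigma\in\mathcal{T}_J,\ \tau\times\sigma\in P^+_{I\times J}\}$, $\mathcal{L}'_J=\{\sigma\in\mathcal{T}_J:\exists\tau\in\mathcal{T}_I,\ \tau\times\sigma\in P^+_{I\times J}\}$.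 For $\tau\in\mathcal{L}'_I$: $\mathrm{row}(\tau)=\{\sigma:\tau\times\sigma\in P^+_{I\times J}\}$ and $\mathcal{F}(\tau)\subseteq J$ is the (disjoint) union of the clusters in $\mathrm{row}(\tau)$. For $\sigma\in\mathcal{L}'_J$: $\mathrm{col}(\sigma)=\{\tau:\tau\times\sigma\in P^+_{I\times J}\}$ and $\mathcal{F}(\sigma)\subseteq I$ is the (disjoint) union of the clusters in $\mathrm{col}(\sigma)$. **Agglomeration matrices.** $A_\tau\in\mathbb{C}^{\tau\times\mathcal{F}(\tau)}$ is the horizontal concatenation of the blocks $A|_{\tau\times\sigma}$, $\sigma\in\mathrm{row}(\tau)$. $A^*_\sigma\in\mathbb{C}^{\sigma\times\mathcal{F}(\sigma)}$ is the horizontal concatenation of the adjoint blocks $(A|_{\tau\times\sigma})^*$, $\tau\in\mathrm{col}(\sigma)$ (the agglomeration matrix of $A^*$ for $\sigma$). **Uniform compression algorithm.** For each $\tau\in\mathcal{L}'_I$, the algorithm computes QR-decompositions $Y_b=Q_{Y,b}R_{Y,b}$ for $b=\tau\times\sigma$, $\sigma\in\mathrm{row}(\tau)$, concatenates the matrices $X_bR_{Y,b}^*$ horizontally into $X_\tau$ (so that $A_\tau=X_\tau Q_\tau^*$ with $Q_\tau$ the block-diagonal matrix of the $Q_{Y,b}$, which has orthonormal columns), computes the SVD of $X_\tau$ and takes $U_\tau\in\mathbb{C}^{\tau\times\ell_\tau}$ to consist of the first $\ell_\tau$ left singular vectors, with $\ell_\tau$ chosen from a prescribed tolerance $\epsilon_\tau$.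 Analogously, for each $\sigma\in\mathcal{L}'_J$, $V_\sigma\in\mathbb{C}^{\sigma\times\ell_\sigma}$ is obtained with the roles of $X_b$ and $Y_b$ exchanged, i.e. from the leading left singular vectors of $A^*_\sigma$. Thus $U_\tau^*U_\tau=I$ and $V_\sigma^*V_\sigma=I$ (this is what ''orthogonal cluster bases'' means). The output $A^{\mathcal{UH}}$ is the matrix with $A^{\mathcal{UH}}|_b=U_\tau S_bV_\sigma^*$, $S_b=U_\tau^*A|_bV_\sigma$, for $b=\tau\times\sigma\in P^+_{I\times J}$, and $A^{\mathcal{UH}}|_b=A|_b$ for $b\in P^-_{I\times J}$. *)

(* Defs.v *)
From mathcomp Require Import classical_sets reals.
From mathcomp Require Import all_boot all_order all_algebra.
From mathcomp Require Import complex.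

Set Implicit Arguments.
Unset Strict Implicit.
Unset Printing Implicit Defensive.

Import Order.TTheory GRing.Theory Num.Theory.
Local Open Scope ring_scope.
Local Open Scope complex_scope.
Local Open Scope sesquilinear_scope.

Section ClusterTrees.

(* The nodes are the subsets themselves, [ct_sons t] is the set s(t) of children
   (empty exactly for the leaves).  [partition] excludes empty parts. *)
Record cluster_tree (I : finType) := ClusterTree {
  ct_nodes : {set {set I}};
  ct_sons : {set I} -> {set {set I}};
  ct_root : [set: I] \in ct_nodes;
  ct_sons_nodes : forall t, t \in ct_nodes -> ct_sons t \subset ct_nodes;
  ct_root_orphan : forall p, p \in ct_nodes -> [set: I] \notin ct_sons p;
  ct_parent : forall t, t \in ct_nodes -> t != [set: I] ->
    exists! p, p \in ct_nodes /\ t \in ct_sons p;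
  ct_connected : forall t, t \in ct_nodes ->
    connect [rel p c | c \in ct_sons p] [set: I] t;
  ct_partition : forall t, t \in ct_nodes -> ct_sons t != set0 ->
    partition (ct_sons t) t
}.

Definition ct_leaves (I : finType) (T : cluster_tree I) : {set {set I}} :=
  [set t in ct_nodes T | ct_sons T t == set0].

Definition block_family (I J : finType) (P : {set {set I}}) (Q : {set {set J}}) :
  {set {set I * J}} := [set setX t s | t in P, s in Q].

(* [bct_adm] is the set of admissible leaves. *)
Record block_cluster_tree (I J : finType)
    (TI : cluster_tree I) (TJ : cluster_tree J) := BlockClusterTree {
  bct_tree :> cluster_tree (I * J)%type;
  bct_nodes : forall b, b \in ct_nodes bct_tree ->
    exists t s, [/\ t \in ct_nodes TI, s \in ct_nodes TJ & b = setX t s];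
  bct_sons : forall t s, t \in ct_nodes TI -> s \in ct_nodes TJ ->
    setX t s \in ct_nodes bct_tree -> ct_sons bct_tree (setX t s) != set0 ->
    [\/ ct_sons bct_tree (setX t s) = block_family (ct_sons TI t) (ct_sons TJ s),
        ct_sons bct_tree (setX t s) = block_family [set t] (ct_sons TJ s)
      | ct_sons bct_tree (setX t s) = block_family (ct_sons TI t) [set s]];
  bct_adm : {set {set I * J}};
  bct_adm_leaves : bct_adm \subset ct_leaves bct_tree
}.

Variables (I J : finType) (TI : cluster_tree I) (TJ : cluster_tree J).
Variable T : block_cluster_tree TI TJ.

Definition bct_inadm : {set {set I * J}} := ct_leaves T :\: bct_adm T.

Definition row_clusters (t : {set I}) : {set {set J}} :=
  [set s in ct_nodes TJ | setX t s \in bct_adm T].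

Definition col_clusters (s : {set J}) : {set {set I}} :=
  [set t in ct_nodes TI | setX t s \in bct_adm T].

(* The sets L'_I and L'_J. *)
Definition adm_rows : {set {set I}} :=
  [set t in ct_nodes TI | [exists s in ct_nodes TJ, setX t s \in bct_adm T]].

Definition adm_cols : {set {set J}} :=
  [set s in ct_nodes TJ | [exists t in ct_nodes TI, setX t s \in bct_adm T]].

Definition row_far_field (t : {set I}) : {set J} :=
  \bigcup_(s in row_clusters t) s.

Definition col_far_field (s : {set J}) : {set I} :=
  \bigcup_(t in col_clusters s) t.

End ClusterTrees.

Section Matrices.
Variable R : realType.
Local Notation C := R[i].

Definition norm2 n (x : 'cV[C]_n) : R :=
  Num.sqrt (\sum_(i < n) Normc.normc (x i 0) ^+ 2).

Definition spectral_norm m n (A : 'M[C]_(m, n)) : R :=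
  sup (fun r : R => exists2 x : 'cV[C]_n, norm2 x <= 1 & r = norm2 (A *m x)).

(* Reduced or full, depending on the inner dimension [r]; the columns of [Q]
   are orthonormal. *)
Definition is_QR m n r (Y : 'M[C]_(m, n)) (Q : 'M[C]_(m, r))
    (T : 'M[C]_(r, n)) : Prop :=
  [/\ Y = Q *m T, Q^t* *m Q = 1%:M
    & forall (i : 'I_r) (j : 'I_n), (j < i)%N -> T i j = 0].

(* Full SVD; only the values [sv k] with [k < minn m n] are meaningful. *)
Definition is_SVD m n (X : 'M[C]_(m, n)) (P : 'M[C]_m) (sv : nat -> R)
    (W : 'M[C]_n) : Prop :=
  [/\ P \is unitarymx, W \is unitarymx,
      forall k, 0 <= sv k, forall k, sv k.+1 <= sv k
    & X = P *m (\matrix_(i < m, j < n) ((sv i)%:C *+ (i == j :> nat))) *m W^t*].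

(* [U] consists of the first [l] left singular vectors of some SVD of [X], all
   discarded singular values being at most [tol].  No further rule for the
   choice of [l] is imposed. *)
Definition leading_singular_vectors m n l (tol : R) (X : 'M[C]_(m, n))
    (U : 'M[C]_(m, l)) : Prop :=
  exists (P : 'M[C]_m) (sv : nat -> R) (W : 'M[C]_n) (lm : (l <= m)%N),
    [/\ is_SVD X P sv W,
        forall k, (l <= k < minn m n)%N -> sv k <= tol
      & U = colsub (widen_ord lm) P].

(* C^{I x J} is represented by 'M[C]_(#|I|, #|J|), and C^{t x s} for subsets t, s
   by 'M[C]_(#|t|, #|s|), through the enumerations [enum_rank] and [enum_val]. *)
Definition block (I J : finType) (A : 'M[C]_(#|I|, #|J|))
    (t : {set I}) (s : {set J}) : 'M[C]_(#|t|, #|s|) :=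
  \matrix_(i < #|t|, j < #|s|) A (enum_rank (enum_val i)) (enum_rank (enum_val j)).

Variables (I J : finType) (TI : cluster_tree I) (TJ : cluster_tree J).
Variable T : block_cluster_tree TI TJ.
Variable A : 'M[C]_(#|I|, #|J|).

Definition row_agglomeration (t : {set I}) :
    'M[C]_(#|t|, \sum_(c < #|row_clusters T t|) #|enum_val c|) :=
  \mxrow_(c < #|row_clusters T t|) block A t (enum_val c).

Definition col_agglomeration (s : {set J}) :
    'M[C]_(#|s|, \sum_(c < #|col_clusters T s|) #|enum_val c|) :=
  \mxrow_(c < #|col_clusters T s|) (block A (enum_val c) s)^t*.

Variable k : {set I} -> {set J} -> nat.
Variable X : forall (t : {set I}) (s : {set J}), 'M[C]_(#|t|, k t s).
Variable Y : forall (t : {set I}) (s : {set J}), 'M[C]_(#|s|, k t s).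

Definition H_matrix : Prop :=
  forall t s, t \in ct_nodes TI -> s \in ct_nodes TJ -> setX t s \in bct_adm T ->
    block A t s = X t s *m (Y t s)^t*.

Definition row_basis (tol : R) (t : {set I}) l (U : 'M[C]_(#|t|, l)) : Prop :=
  exists (r : {set J} -> nat) (Q : forall s : {set J}, 'M[C]_(#|s|, r s))
         (RY : forall s : {set J}, 'M[C]_(r s, k t s)),
    (forall s, s \in row_clusters T t -> is_QR (Y t s) (Q s) (RY s)) /\
    leading_singular_vectors tol
      (\mxrow_(c < #|row_clusters T t|)
         (X t (enum_val c) *m (RY (enum_val c))^t*)) U.

Definition col_basis (tol : R) (s : {set J}) l (V : 'M[C]_(#|s|, l)) : Prop :=
  exists (r : {set I} -> nat) (Q : forall t : {set I}, 'M[C]_(#|t|, r t))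
         (RX : forall t : {set I}, 'M[C]_(r t, k t s)),
    (forall t, t \in col_clusters T s -> is_QR (X t s) (Q t) (RX t)) /\
    leading_singular_vectors tol
      (\mxrow_(c < #|col_clusters T s|)
         (Y (enum_val c) s *m (RX (enum_val c))^t*)) V.

(* [U], [V] and [AUH] are an outcome of the algorithm run on the factors [X], [Y]
   with tolerances [tolI], [tolJ]; it is a relation because QR and singular value
   decompositions are not unique. *)
Definition uniform_compression (tolI : {set I} -> R) (tolJ : {set J} -> R)
    (lI : {set I} -> nat) (U : forall t : {set I}, 'M[C]_(#|t|, lI t))
    (lJ : {set J} -> nat) (V : forall s : {set J}, 'M[C]_(#|s|, lJ s))
    (AUH : 'M[C]_(#|I|, #|J|)) : Prop :=
  [/\ forall t, t \in adm_rows T -> row_basis (tolI t) (U t),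
      forall s, s \in adm_cols T -> col_basis (tolJ s) (V s),
      forall t s, t \in ct_nodes TI -> s \in ct_nodes TJ ->
        setX t s \in bct_adm T ->
        let S := (U t)^t* *m block A t s *m V s in
        block AUH t s = U t *m S *m (V s)^t*
    & forall t s, t \in ct_nodes TI -> s \in ct_nodes TJ ->
        setX t s \in bct_inadm T -> block AUH t s = block A t s].

Definition row_error (t : {set I}) l (U : 'M[C]_(#|t|, l)) : R :=
  spectral_norm (row_agglomeration t - U *m U^t* *m row_agglomeration t).

Definition col_error (s : {set J}) l (V : 'M[C]_(#|s|, l)) : R :=
  spectral_norm (col_agglomeration s - V *m V^t* *m col_agglomeration s).

End Matrices.

(* Main.v *)
(* On an admissible block b = t x s the error is
     (A_b - U_t U_t^* A_b) + U_t U_t^* (A_b - A_b V_s V_s^* ).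
   For vectors x, y the form y^T (A - AUH) x is therefore a sum over the row
   clusters t of terms bounded by row_error t |y_t| |x_F(t)|, plus a sum over the
   column clusters s of terms bounded by col_error s |x_s| |y_F(s)|.  The leaves of
   the block cluster tree are pairwise disjoint, so that the sums over t of
   |y_t|^2 |x_F(t)|^2 and over s of |x_s|^2 |y_F(s)|^2 are at most |x|^2 |y|^2, and
   the Cauchy-Schwarz inequality gives the first bound.  The scaled version follows
   since disjointness also bounds the sum of |t| |F(t)| by |I| |J|. *)

Require Import Defs.
From mathcomp Require Import classical_sets reals.
From mathcomp Require Import all_boot all_order all_algebra.
From mathcomp Require Import complex ring lra.

Set Implicit Arguments.
Unset Strict Implicit.
Unset Printing Implicit Defensive.

Import Order.TTheory GRing.Theory Num.Theory.
Local Open Scope ring_scope.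
Local Open Scope complex_scope.

(** * Leaves of a cluster tree: they are pairwise disjoint and cover the index set *)

Section ClusterTreeLeaves.
Variables (I : finType) (T : cluster_tree I).

Lemma ct_son_sub t c : t \in ct_nodes T -> c \in ct_sons T t -> c \subset t.
Proof.
move=> tT ct; have s0 : ct_sons T t != set0 by apply/set0Pn; exists c.
by rewrite -(cover_partition (ct_partition tT s0)) bigcup_sup.
Qed.

Lemma ct_path_last t p : t \in ct_nodes T ->
  path [rel a c | c \in ct_sons T a] t p ->
  last t p \in ct_nodes T /\ last t p \subset t.
Proof.
elim: p t => [|c p IH] t tT //= /andP[ct pp].
have cT : c \in ct_nodes T := subsetP (ct_sons_nodes tT) c ct.
have [? sub] := IH c cT pp; split => //.
exact: fintype.subset_trans sub (ct_son_sub tT ct).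
Qed.

(* A node listed among its own children would be its own unique parent, hence
   unreachable from the root. *)
Lemma ct_son_irrefl t : t \in ct_nodes T -> t \notin ct_sons T t.
Proof.
move=> tT; apply/negP => tt.
have tI : t != [set: I] by apply: contraL tt => /eqP ->; apply: ct_root_orphan; rewrite ?ct_root.
have /connectP[q /shortenP[p pp Up _] def_t] := ct_connected tT.
case: (lastP p) pp Up def_t => [|p' c] pp Up; first by move=> /= E; rewrite E eqxx in tI.
rewrite last_rcons => E; subst c.
move: pp; rewrite rcons_path => /andP[pp /= tp].
have [pT _] := ct_path_last (ct_root T) pp.
have [par [_ uniq_par]] := ct_parent tT tI.
have E : t = last [set: I] p' by rewrite -(uniq_par _ (conj tT tt)); apply: uniq_par.
by move: Up; rewrite -rcons_cons rcons_uniq {1}E mem_last.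
Qed.

(** Every node other than the root is a part of a partition, and such parts are nonempty; the root
    is nonempty by the assumption on [I]. *)
Lemma ct_node_neq0 t : (0 < #|I|)%N -> t \in ct_nodes T -> t != set0.
Proof.
move=> I0 tT; have [->|tI] := eqVneq t [set: I].
  by rewrite -card_gt0 cardsT.
have [p [[pT tp] _]] := ct_parent tT tI.
have s0 : ct_sons T p != set0 by apply/set0Pn; exists t.
have /and3P[_ _ n0] := ct_partition pT s0.
by apply: contraNneq n0 => <-.
Qed.

(** Descend both paths together. Children of a node are disjoint, so the shared index [i] forces the
    same child at each step; neither path can stop before the other, since a leaf has no
    children. *)
Lemma ct_leaf_disjoint t p q i : t \in ct_nodes T ->
  path [rel a c | c \in ct_sons T a] t p -> path [rel a c | c \in ct_sons T a] t q ->
  ct_sons T (last t p) = set0 -> ct_sons T (last t q) = set0 ->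
  i \in last t p -> i \in last t q -> last t p = last t q.
Proof.
elim: p t q => [|c p IH] t [|d q] tT //=.
- by move=> _ /andP[dt _] E; rewrite E inE in dt.
- by move=> /andP[dt _] _ _ E; rewrite E inE in dt.
move=> /andP[ct pc] /andP[dt pd] lp lq ip iq.
have cT : c \in ct_nodes T := subsetP (ct_sons_nodes tT) c ct.
have dT : d \in ct_nodes T := subsetP (ct_sons_nodes tT) d dt.
have ic : i \in c := subsetP (ct_path_last cT pc).2 i ip.
have id : i \in d := subsetP (ct_path_last dT pd).2 i iq.
have s0 : ct_sons T t != set0 by apply/set0Pn; exists c.
have /and3P[_ /trivIsetP triv _] := ct_partition tT s0.
have cd : c = d.
  apply/eqP; apply/negPn/negP => ncd.
  by have /pred0P/(_ i) /= := triv _ _ ct dt ncd; rewrite ic id.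
by subst d; apply: (IH c q).
Qed.

Lemma ct_leaves_trivIset : trivIset (ct_leaves T).
Proof.
apply/trivIsetP => a b; rewrite !inE => /andP[aT /eqP la] /andP[bT /eqP lb].
apply: contraNT => /pred0Pn[i /andP[/= ia ib]].
have /connectP[p pp def_a] := ct_connected aT.
have /connectP[q pq def_b] := ct_connected bT.
apply/eqP; rewrite def_a def_b.
by apply: (@ct_leaf_disjoint _ p q i (ct_root T)); rewrite -?def_a -?def_b.
Qed.

Lemma ct_leaves_cover : cover (ct_leaves T) = [set: I].
Proof.
apply/setP => i; rewrite inE; apply/bigcupP.
have iT : ([set: I] \in ct_nodes T) && (i \in [set: I]) by rewrite ct_root inE.
(* A node of least cardinality containing [i] is a leaf: otherwise a child containing [i] would be
   at least as large, hence equal to its own parent. *)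
have [t /andP[tT it] tmin] := @arg_minnP _ [set: I]
  (fun t => (t \in ct_nodes T) && (i \in t)) (fun t => #|t|) iT.
exists t => //; rewrite inE tT; apply/negPn/negP => s0.
have it' := it; rewrite -(cover_partition (ct_partition tT s0)) in it'.
have /bigcupP[c ct ic] := it'.
have cT : c \in ct_nodes T := subsetP (ct_sons_nodes tT) c ct.
have := tmin c; rewrite cT ic => /(_ isT) le_tc.
have E : c = t by apply/eqP; rewrite eqEcard (ct_son_sub tT ct) le_tc.
by have := ct_son_irrefl tT; rewrite -{1}E ct.
Qed.

End ClusterTreeLeaves.

(** * Sums over the admissible blocks, grouped by rows, by columns, or by matrix entries *)

Section BlockClusterTreeLeaves.
Variables (I J : finType) (TI : cluster_tree I) (TJ : cluster_tree J).
Variable T : block_cluster_tree TI TJ.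

Lemma bct_adm_trivIset : trivIset (bct_adm T).
Proof. exact: trivIsetS (bct_adm_leaves T) (ct_leaves_trivIset T). Qed.

Lemma row_clusters_adm_rows t s :
  t \in adm_rows T -> s \in row_clusters T t ->
  [/\ t \in ct_nodes TI, s \in ct_nodes TJ & setX t s \in bct_adm T].
Proof. by rewrite !inE => /andP[-> _] /andP[-> ->]. Qed.

Lemma col_clusters_adm_cols t s :
  s \in adm_cols T -> t \in col_clusters T s ->
  [/\ t \in ct_nodes TI, s \in ct_nodes TJ & setX t s \in bct_adm T].
Proof. by rewrite !inE => /andP[-> _] /andP[-> ->]. Qed.

Lemma adm_blockP b : b \in bct_adm T ->
  exists t s, [/\ t \in ct_nodes TI, s \in ct_nodes TJ & b = setX t s].
Proof.
move=> /(subsetP (bct_adm_leaves T)); rewrite inE => /andP[bT _].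
exact: bct_nodes bT.
Qed.

(** Both sides enumerate the admissible pairs; the outer index sets are exactly the clusters having
    at least one partner. This passes from row bases to column bases. *)
Lemma exchange_adm (V : nmodType) (G : {set I} -> {set J} -> V) :
  \sum_(t in adm_rows T) \sum_(s in row_clusters T t) G t s =
  \sum_(s in adm_cols T) \sum_(t in col_clusters T s) G t s.
Proof.
rewrite (exchange_big_dep (mem (adm_cols T))) /=; last first.
  move=> t s tr /(row_clusters_adm_rows tr)[tT sT ts].
  by rewrite inE sT; apply/existsP; exists t; rewrite tT.
apply: eq_bigr => s; rewrite inE => /andP[sT _]; apply: eq_bigl => t.
rewrite !inE sT; case tT: (t \in _) => //=.
by apply/andP/idP => [[]//|ts]; split=> //; apply/existsP; exists s; rewrite sT.
Qed.

Hypotheses (I_gt0 : (0 < #|I|)%N) (J_gt0 : (0 < #|J|)%N).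

(** Nonempty factors can be recovered from a product by fixing one coordinate; a product with an
    empty factor would forget the other one. *)
Lemma node_setX_inj :
  {in [pred p : {set I} * {set J} | (p.1 \in ct_nodes TI) && (p.2 \in ct_nodes TJ)] &,
   injective (fun p => setX p.1 p.2)}.
Proof.
move=> [t s] [t' s']; rewrite !inE /= => /andP[tT sT] /andP[tT' sT'] E.
have /set0Pn[i it] := ct_node_neq0 I_gt0 tT.
have /set0Pn[j js] := ct_node_neq0 J_gt0 sT.
have mem a b : (a \in t) && (b \in s) = (a \in t') && (b \in s').
  by have /setP/(_ (a, b)) := E; rewrite !inE.
have := mem i j; rewrite it js => /esym/andP[it' js'].
congr pair; apply/setP => x; first by have := mem x j; rewrite js js' !andbT.
by have := mem i x; rewrite it it'.
Qed.

(** Admissible blocks correspond bijectively to pairs of clusters and are disjoint, so each entry is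
    counted once. It is applied with [F] constant, with the terms of a bilinear form, and with
    products of squared moduli. *)
Lemma sum_adm_rows (V : nmodType) (F : I -> J -> V) :
  \sum_(t in adm_rows T) \sum_(s in row_clusters T t)
     \sum_(i in t) \sum_(j in s) F i j =
  \sum_(p in cover (bct_adm T)) F p.1 p.2.
Proof.
rewrite big_trivIset ?bct_adm_trivIset //=.
pose D := [pred p : {set I} * {set J} |
   [&& p.1 \in ct_nodes TI, p.2 \in ct_nodes TJ & setX p.1 p.2 \in bct_adm T]].
have -> : bct_adm T = [set setX p.1 p.2 | p in D].
  apply/setP => b; apply/idP/imsetP => [bT|[[t s] /and3P[_ _ ?] ->] //].
  have [t [s [tT sT E]]] := adm_blockP bT.
  by exists (t, s) => //; rewrite inE /= tT sT -E.
rewrite big_imset /=; last first.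
  move=> p q; rewrite !inE => /and3P[p1 p2 _] /and3P[q1 q2 _].
  by apply: node_setX_inj; rewrite inE ?p1 ?q1.
rewrite pair_big_dep /=; apply: eq_big => [[t s]|[t s] _] /=.
  rewrite !inE; case: (t \in _) => //=; case sT: (s \in _); rewrite ?andbF //=.
  by apply/andP/idP => [[]//|ts]; split=> //; apply/existsP; exists s; rewrite sT.
by rewrite pair_big /=; apply: eq_bigl => -[i j]; rewrite inE.
Qed.

Lemma sum_adm_rows_card :
  (\sum_(t in adm_rows T) \sum_(s in row_clusters T t) #|t| * #|s| <= #|I| * #|J|)%N.
Proof.
have E (t : {set I}) (s : {set J}) : (#|t| * #|s| = \sum_(i in t) \sum_(j in s) 1)%N.
  by rewrite sum_nat_const sum1_card.
under eq_bigr do under eq_bigr do rewrite E.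
by rewrite (sum_adm_rows (fun _ _ => 1%N)) sum1_card -card_prod max_card.
Qed.

(** The size of a far field is at most the sum of the sizes of its clusters, and the admissible
    blocks together have at most |I| |J| entries. *)
Lemma sum_row_far_field_card :
  (\sum_(t in adm_rows T) #|t| * #|row_far_field T t| <= #|I| * #|J|)%N.
Proof.
apply: leq_trans sum_adm_rows_card; apply: leq_sum => t _.
by rewrite -big_distrr leq_mul2l (leq_card_cover (row_clusters T t)) orbT.
Qed.

Lemma sum_col_far_field_card :
  (\sum_(s in adm_cols T) #|s| * #|col_far_field T s| <= #|I| * #|J|)%N.
Proof.
have := sum_adm_rows_card; rewrite exchange_adm; apply: leq_trans.
apply: leq_sum => s _.
by rewrite -big_distrl mulnC leq_mul2r (leq_card_cover (col_clusters T s)) orbT.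
Qed.

End BlockClusterTreeLeaves.

(** * Cauchy-Schwarz and square root inequalities for finite sums *)

(** Lagrange's identity: twice the gap is the sum over all ordered pairs of (f_i g_j - f_j
    g_i)^2. *)
Lemma CauchySchwarz_sum (R : realDomainType) (K : finType) (P : pred K) (f g : K -> R) :
  (\sum_(i | P i) f i * g i) ^+ 2 <=
  (\sum_(i | P i) f i ^+ 2) * (\sum_(i | P i) g i ^+ 2).
Proof.
rewrite -subr_ge0 -(@pmulr_rge0 _ 2) //.
suff -> : 2 * ((\sum_(i | P i) f i ^+ 2) * (\sum_(i | P i) g i ^+ 2)
               - (\sum_(i | P i) f i * g i) ^+ 2) =
          \sum_(i | P i) \sum_(j | P j) (f i * g j - f j * g i) ^+ 2.
  by do 2!(apply: sumr_ge0 => ? _); apply: sqr_ge0.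
have E i j : (f i * g j - f j * g i) ^+ 2 =
    f i ^+ 2 * g j ^+ 2 + g i ^+ 2 * f j ^+ 2 + -2 * (f i * g i) * (f j * g j) by ring.
under [RHS]eq_bigr => i _.
  under eq_bigr do rewrite E.
  rewrite !big_split /= -!mulr_sumr; over.
rewrite !big_split /= -!mulr_suml -mulr_sumr; ring.
Qed.

(** Cauchy-Schwarz for [e] against [a] times the root of [b]. In the application [e] is the local
    error, [a] the norm of a vector on a cluster, [b] the squared norm of the other vector on the
    far field, and [N] the product of the full norms. *)
Lemma sum_mulr_sqrtr_le (R : rcfType) (K : finType) (P : pred K) (e a b : K -> R) (N : R) :
  (forall c, P c -> 0 <= b c) ->
  \sum_(c | P c) a c ^+ 2 * b c <= N ^+ 2 -> 0 <= N ->
  \sum_(c | P c) e c * (a c * Num.sqrt (b c)) <= Num.sqrt (\sum_(c | P c) e c ^+ 2) * N.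
Proof.
move=> b0 HN N0; rewrite -[N in leRHS]ger0_norm // -sqrtr_sqr -sqrtrM; last first.
  by apply: sumr_ge0 => ? _; apply: sqr_ge0.
apply: le_trans (ler_norm _) _; rewrite -sqrtr_sqr; apply: ler_wsqrtr.
apply: le_trans (CauchySchwarz_sum _ _ _) _.
apply: ler_wpM2l; first by apply: sumr_ge0 => ? _; apply: sqr_ge0.
apply: le_trans HN; apply: ler_sum => c /b0 bc.
by rewrite exprMn sqr_sqrtr.
Qed.

(** The origin of the factor [Num.sqrt 2], which merges the row and column contributions under one
    root. The squares of the two sides differ by the square of the difference of the roots. *)
Lemma sqrtrD_le (R : rcfType) (a b : R) : 0 <= a -> 0 <= b ->
  Num.sqrt a + Num.sqrt b <= Num.sqrt 2 * Num.sqrt (a + b).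
Proof.
move=> a0 b0; rewrite -sqrtrM // -[leLHS]ger0_norm ?addr_ge0 ?sqrtr_ge0 //.
rewrite -sqrtr_sqr; apply: ler_wsqrtr.
rewrite -{2}(sqr_sqrtr a0) -{2}(sqr_sqrtr b0) -subr_ge0.
by rewrite (_ : _ - _ = (Num.sqrt a - Num.sqrt b) ^+ 2) ?sqr_ge0 //; ring.
Qed.

(** * Euclidean and spectral norms of complex vectors and matrices *)

Section SpectralNorm.
Variable R : realType.
Local Notation C := R[i].
Local Open Scope sesquilinear_scope.
Local Notation normc := (@Normc.normc R).

Lemma normcE_norm (z : C) : (normc z)%:C = `|z|.
Proof. by []. Qed.

Lemma normc_ge0 (z : C) : 0 <= normc z.
Proof. by case: z => a b; apply: sqrtr_ge0. Qed.

Lemma normc_conj (z : C) : normc (z^*)%R = normc z.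
Proof. by apply: complexI; rewrite !normcE_norm norm_conjC. Qed.

Lemma normc_sum (K : Type) (r : seq K) (P : pred K) (F : K -> C) :
  normc (\sum_(i <- r | P i) F i) <= \sum_(i <- r | P i) normc (F i).
Proof.
elim/big_rec2: _ => [|i x z _ le_zx]; first by rewrite Normc.normc0.
exact: le_trans (le_normcD _ _) (lerD _ _).
Qed.

Lemma adjmxM m n p (A : 'M[C]_(m, n)) (B : 'M[C]_(n, p)) :
  (A *m B)^t* = B^t* *m A^t*.
Proof. by rewrite trmx_mul map_mxM. Qed.

Lemma adjmxK m n (A : 'M[C]_(m, n)) : (A^t*)^t* = A.
Proof. by apply/matrixP => i j; rewrite !mxE conjCK. Qed.

Lemma sqr_norm2 n (x : 'cV[C]_n) : norm2 x ^+ 2 = \sum_(i < n) normc (x i 0) ^+ 2.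
Proof. by rewrite sqr_sqrtr // sumr_ge0 // => i _; apply: sqr_ge0. Qed.

Lemma norm2_ge0 n (x : 'cV[C]_n) : 0 <= norm2 x.
Proof. exact: sqrtr_ge0. Qed.

Lemma sqr_norm2E n (x : 'cV[C]_n) : (norm2 x ^+ 2)%:C = (x^t* *m x) 0 0.
Proof.
rewrite sqr_norm2 rmorph_sum mxE; apply: eq_bigr => i _.
by rewrite !mxE rmorphXn [X in X ^+ 2]normcE_norm normCK mulrC.
Qed.

Lemma norm2_0 n : norm2 (0 : 'cV[C]_n) = 0.
Proof.
by rewrite /norm2 big1 ?sqrtr0 // => i _; rewrite mxE Normc.normc0 expr0n.
Qed.

Lemma norm2Z n (a : R) (x : 'cV[C]_n) : 0 <= a -> norm2 (a%:C *: x) = a * norm2 x.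
Proof.
move=> a0; apply: (@pexpIrn _ 2); rewrite ?nnegrE ?mulr_ge0 ?norm2_ge0 //.
rewrite exprMn !sqr_norm2 mulr_sumr; apply: eq_bigr => i _.
by rewrite mxE Normc.normcM exprMn /= expr0n addr0 sqrtr_sqr ger0_norm.
Qed.

Lemma norm2_eq0 n (x : 'cV[C]_n) : norm2 x = 0 -> x = 0.
Proof.
move=> x0; apply/matrixP => i j; rewrite ord1 mxE.
have /eqP := sqr_norm2 x; rewrite x0 expr0n eq_sym psumr_eq0; last first.
  by move=> ? _; apply: sqr_ge0.
by move=> /allP/(_ i (mem_index_enum _)); rewrite sqrf_eq0 => /eqP/Normc.eq0_normc.
Qed.

Lemma normc_dot_le m n (y : 'rV[C]_m) (M : 'M[C]_(m, n)) (x : 'cV[C]_n) :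
  normc ((y *m M *m x) 0 0) <= norm2 y^T * norm2 (M *m x).
Proof.
rewrite -mulmxA mxE; apply: le_trans (normc_sum _ _ _) _.
rewrite -ler_sqr ?nnegrE ?mulr_ge0 ?norm2_ge0 ?sumr_ge0 //; last first.
  by move=> i _; apply: normc_ge0.
rewrite exprMn !sqr_norm2; under eq_bigr do rewrite Normc.normcM.
apply: le_trans (CauchySchwarz_sum _ _ _) _.
by under [X in _ <= X * _]eq_bigr do rewrite mxE.
Qed.

(** The supremum property of [sup] is available only for nonempty sets bounded above; the Frobenius
    norm serves as the bound. *)
Lemma has_sup_spectral_norm m n (M : 'M[C]_(m, n)) :
  has_sup (fun r : R => exists2 x : 'cV[C]_n, norm2 x <= 1 & r = norm2 (M *m x)).
Proof.
split; first by exists 0, 0; rewrite ?mulmx0 norm2_0.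
exists (Num.sqrt (\sum_i \sum_j normc (M i j) ^+ 2)) => _ [x x1 ->].
apply: ler_wsqrtr; apply: ler_sum => i _; rewrite mxE.
have le1 := normc_sum (index_enum 'I_n) xpredT (fun j => M i j * x j 0).
apply: (@le_trans _ _ ((\sum_j normc (M i j * x j 0)) ^+ 2)).
  by rewrite ler_sqr ?nnegrE ?normc_ge0 ?sumr_ge0 // => ? _; apply: normc_ge0.
under eq_bigr do rewrite Normc.normcM.
apply: le_trans (CauchySchwarz_sum _ _ _) _.
rewrite -sqr_norm2 -[leRHS]mulr1; apply: ler_wpM2l.
  by apply: sumr_ge0 => ? _; apply: sqr_ge0.
by rewrite expr_le1 ?norm2_ge0.
Qed.

Lemma spectral_norm_ge0 m n (M : 'M[C]_(m, n)) : 0 <= spectral_norm M.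
Proof.
apply: (sup_upper_bound (has_sup_spectral_norm M)).
by exists 0; rewrite ?mulmx0 norm2_0.
Qed.

Lemma norm2_mulmx_le m n (M : 'M[C]_(m, n)) (x : 'cV[C]_n) :
  norm2 (M *m x) <= spectral_norm M * norm2 x.
Proof.
have [/norm2_eq0 ->|x0] := eqVneq (norm2 x) 0; first by rewrite mulmx0 !norm2_0 mulr0.
have x_gt0 : 0 < norm2 x by rewrite lt_def x0 norm2_ge0.
rewrite -ler_pdivrMr // mulrC.
apply: (sup_upper_bound (has_sup_spectral_norm M)).
have inv0 : 0 <= (norm2 x)^-1 by rewrite invr_ge0 norm2_ge0.
exists ((norm2 x)^-1%:C *: x); rewrite -?scalemxAr norm2Z // mulVf //.
Qed.

Lemma normc_bilinear_le m n (y : 'rV[C]_m) (M : 'M[C]_(m, n)) (x : 'cV[C]_n) :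
  normc ((y *m M *m x) 0 0) <= spectral_norm M * (norm2 y^T * norm2 x).
Proof.
apply: le_trans (normc_dot_le _ _ _) _.
by rewrite mulrCA ler_wpM2l ?norm2_ge0 ?norm2_mulmx_le.
Qed.

Lemma norm2_conj n (x : 'cV[C]_n) : norm2 (map_mx Num.conj x) = norm2 x.
Proof. by rewrite /norm2; under eq_bigr do rewrite mxE normc_conj. Qed.

(** Reduces a norm bound to bilinear forms, which are additive over blocks. The converse of
    [normc_bilinear_le]. *)
Lemma spectral_norm_le m n (M : 'M[C]_(m, n)) (K : R) : 0 <= K ->
  (forall y x, normc ((y *m M *m x) 0 0) <= K * (norm2 y^T * norm2 x)) ->
  spectral_norm M <= K.
Proof.
move=> K0 HK; apply: ge_sup => [|_ [x x1 ->]].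
  by exists 0, 0; rewrite ?mulmx0 norm2_0.
(* With y the adjoint of M x the form equals |M x|^2, and one factor |M x| cancels. *)
have := HK ((M *m x)^t*) x; rewrite -mulmxA -sqr_norm2E.
rewrite /= expr0n addr0 sqrtr_sqr ger0_norm ?sqr_ge0 // map_trmx trmxK norm2_conj.
have [-> //|y0] := eqVneq (norm2 (M *m x)) 0.
have y_gt0 : 0 < norm2 (M *m x) by rewrite lt_def y0 norm2_ge0.
rewrite mulrCA expr2 ler_pM2l // => /le_trans; apply.
by rewrite ler_piMr.
Qed.

Lemma sqr_norm2_mxcol p (p_ : 'I_p -> nat) (x : forall c, 'cV[C]_(p_ c)) :
  norm2 (\mxcol_c x c) ^+ 2 = \sum_c norm2 (x c) ^+ 2.
Proof.
apply: complexI; rewrite sqr_norm2E rmorph_sum tr_mxcol.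
rewrite (_ : map_mx _ _ = \mxrow_c (x c)^t*); last first.
  by apply/matrixP => i j; rewrite !mxE.
rewrite mul_mxrow_mxcol summxE; apply: eq_bigr => c _.
exact: (esym (sqr_norm2E _)).
Qed.

(** As U U^* is Hermitian and idempotent, p = U U^* x satisfies p^* p = p^* x, and Cauchy-Schwarz
    gives |p|^2 <= |p| |x|. *)
Lemma norm2_proj_le n l (U : 'M[C]_(n, l)) (x : 'cV[C]_n) :
  U^t* *m U = 1%:M -> norm2 (U *m U^t* *m x) <= norm2 x.
Proof.
move=> UU; set p := U *m U^t* *m x.
have [-> |p0] := eqVneq (norm2 p) 0; first exact: norm2_ge0.
have p_gt0 : 0 < norm2 p by rewrite lt_def p0 norm2_ge0.
have E : p^t* *m p = p^t* *m 1%:M *m x.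
  by rewrite mulmx1 /p !adjmxM adjmxK !mulmxA -(mulmxA _ (U^t*) U) UU mulmx1.
have := normc_dot_le (p^t*) 1%:M x.
rewrite -E -sqr_norm2E mul1mx map_trmx trmxK norm2_conj /= expr0n addr0 sqrtr_sqr.
by rewrite ger0_norm ?sqr_ge0 // expr2 ler_pM2l.
Qed.

Lemma leading_singular_vectors_orthonormal m n l (tol : R) (M : 'M[C]_(m, n))
    (U : 'M[C]_(m, l)) :
  leading_singular_vectors tol M U -> U^t* *m U = 1%:M.
Proof.
case=> P [sv [W [lm [[Pu _ _ _ _] _ ->]]]].
(* [unitarymx] provides P P^* = 1; orthonormality of the columns is the other product, equivalent
   because P is square. *)
have PP : P^t* *m P = 1%:M by apply: mulmx1C; apply/unitarymxP.
apply/matrixP => i j; have /matrixP/(_ (widen_ord lm i) (widen_ord lm j)) := PP.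
rewrite !mxE -!val_eqE /= => <-.
by apply: eq_bigr => c _; rewrite !mxE.
Qed.

End SpectralNorm.

(** * Bilinear forms restricted to blocks, and their bounds by agglomeration errors *)

Section BlockForms.
Variable R : realType.
Local Notation C := R[i].
Local Open Scope sesquilinear_scope.
Local Notation normc := (@Normc.normc R).

(** Stacking the vectors [x c] turns the sum into a single form of the concatenated matrix. One
    spectral norm thus controls a whole block row, as opposed to one norm per block. *)
Lemma normc_mxrow_bilinear_le m p (q_ : 'I_p -> nat) (B : forall c, 'M[C]_(m, q_ c))
    (y : 'rV[C]_m) (x : forall c, 'cV[C]_(q_ c)) :
  normc (\sum_c (y *m B c *m x c) 0 0) <=
  spectral_norm (\mxrow_c B c) * (norm2 y^T * Num.sqrt (\sum_c norm2 (x c) ^+ 2)).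
Proof.
have -> : Num.sqrt (\sum_c norm2 (x c) ^+ 2) = norm2 (\mxcol_c x c).
  by rewrite -sqr_norm2_mxcol sqrtr_sqr ger0_norm ?norm2_ge0.
apply: le_trans (normc_bilinear_le _ _ _).
by rewrite mul_mxrow mul_mxrow_mxcol summxE.
Qed.

(** Restriction to a cluster, indexed by the same enumerations as [block]. *)
Definition subcol (K : finType) (x : 'cV[C]_#|K|) (s : {set K}) : 'cV[C]_#|s| :=
  \col_j x (enum_rank (enum_val j)) 0.

Lemma sqr_norm2_subcol (K : finType) (x : 'cV[C]_#|K|) (s : {set K}) :
  norm2 (subcol x s) ^+ 2 = \sum_(j in s) normc (x (enum_rank j) 0) ^+ 2.
Proof. by rewrite sqr_norm2 [RHS]big_enum_val; apply: eq_bigr => j _; rewrite mxE. Qed.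

Lemma sqr_norm2_enum (K : finType) (x : 'cV[C]_#|K|) :
  norm2 x ^+ 2 = \sum_(j : K) normc (x (enum_rank j) 0) ^+ 2.
Proof. by rewrite sqr_norm2 (reindex enum_rank) //; apply/onW_bij/enum_rank_bij. Qed.

Variables I J : finType.
Implicit Types (M : 'M[C]_(#|I|, #|J|)) (y : 'cV[C]_#|I|) (x : 'cV[C]_#|J|).

Lemma blockB M M' (t : {set I}) (s : {set J}) :
  block (M - M') t s = block M t s - block M' t s.
Proof. by apply/matrixP => i j; rewrite !mxE. Qed.

Lemma block_bilinearE M y x (t : {set I}) (s : {set J}) :
  ((subcol y t)^T *m block M t s *m subcol x s) 0 0 =
  \sum_(i in t) \sum_(j in s)
    y (enum_rank i) 0 * M (enum_rank i) (enum_rank j) * x (enum_rank j) 0.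
Proof.
rewrite -mulmxA mxE [RHS]big_enum_val; apply: eq_bigr => i _.
rewrite !mxE [RHS]big_enum_val mulr_sumr; apply: eq_bigr => j _.
by rewrite !mxE mulrA.
Qed.

Lemma bilinear_enumE M y x :
  (y^T *m M *m x) 0 0 =
  \sum_(i : I) \sum_(j : J)
    y (enum_rank i) 0 * M (enum_rank i) (enum_rank j) * x (enum_rank j) 0.
Proof.
rewrite -mulmxA mxE (reindex enum_rank) /=; last exact/onW_bij/enum_rank_bij.
apply: eq_bigr => i _; rewrite !mxE (reindex enum_rank) /=; last exact/onW_bij/enum_rank_bij.
by rewrite mulr_sumr; apply: eq_bigr => j _; rewrite mulrA.
Qed.

Variables (TI : cluster_tree I) (TJ : cluster_tree J).
Variable T : block_cluster_tree TI TJ.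
Variable A : 'M[C]_(#|I|, #|J|).

(** Left multiplication by U U^* commutes with horizontal concatenation, so the residuals of the
    blocks concatenate to the residual of the agglomeration matrix. *)
Lemma row_projection_error_le y x (t : {set I}) l (U : 'M[C]_(#|t|, l)) :
  normc (\sum_(s in row_clusters T t)
    ((subcol y t)^T *m (block A t s - U *m U^t* *m block A t s) *m subcol x s) 0 0) <=
  row_error T A U * (norm2 (subcol y t) *
    Num.sqrt (\sum_(s in row_clusters T t) norm2 (subcol x s) ^+ 2)).
Proof.
rewrite [X in normc X]big_enum_val [X in Num.sqrt X]big_enum_val /row_error /row_agglomeration mul_mxrow -mxrowB.
by rewrite -{2}[subcol y t]trmxK normc_mxrow_bilinear_le.
Qed.

(* Conjugating turns the blocks into those of the agglomeration matrix of the
   adjoint; the projections U_t U_t^* are absorbed into the row vectors. *)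
Lemma col_projection_error_le y x (s : {set J}) l (V : 'M[C]_(#|s|, l))
    (lI : {set I} -> nat) (U : forall t : {set I}, 'M[C]_(#|t|, lI t)) :
  (forall t, t \in col_clusters T s -> (U t)^t* *m U t = 1%:M) ->
  normc (\sum_(t in col_clusters T s)
    ((subcol y t)^T *m (U t *m (U t)^t* *m (block A t s - block A t s *m V *m V^t*))
       *m subcol x s) 0 0) <=
  col_error T A V * (norm2 (subcol x s) *
    Num.sqrt (\sum_(t in col_clusters T s) norm2 (subcol y t) ^+ 2)).
Proof.
move=> UU; pose z t := U t *m (U t)^t* *m map_mx Num.conj (subcol y t).
rewrite -normc_conj rmorph_sum /=.
have E t : (((subcol y t)^T *m (U t *m (U t)^t* *m
      (block A t s - block A t s *m V *m V^t*)) *m subcol x s) 0 0)^* =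
    ((subcol x s)^t* *m ((block A t s)^t* - V *m V^t* *m (block A t s)^t*) *m z t) 0 0.
  have conj11 (M : 'M[C]_1) : (M 0 0)^* = (M^t*) 0 0 by rewrite !mxE.
  rewrite conj11 !adjmxM adjmxK linearB /= map_mxB !adjmxM adjmxK !mulmxA.
  by congr ((_ *m _) 0 0); apply/matrixP => i j; rewrite !mxE.
rewrite (eq_bigr _ (fun t _ => E t)).
apply: (@le_trans _ _ (col_error T A V * (norm2 (subcol x s) *
    Num.sqrt (\sum_(t in col_clusters T s) norm2 (z t) ^+ 2)))).
  rewrite [X in normc X]big_enum_val [X in Num.sqrt X]big_enum_val /col_error /col_agglomeration mul_mxrow -mxrowB.
  have -> : norm2 (subcol x s) = norm2 ((subcol x s)^t*)^T.
    by rewrite map_trmx trmxK norm2_conj.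
  exact: normc_mxrow_bilinear_le.
apply: ler_wpM2l; first exact: spectral_norm_ge0.
apply: ler_wpM2l; first exact: norm2_ge0.
apply: ler_wsqrtr; apply: ler_sum => t /UU Ut.
rewrite ler_sqr ?nnegrE ?norm2_ge0 //.
by rewrite (le_trans (norm2_proj_le _ Ut)) ?norm2_conj.
Qed.

End BlockForms.

(** * The error of the compressed matrix as a bilinear form *)

Section UniformCompression.
Variable R : realType.
Local Notation C := R[i].
Local Open Scope sesquilinear_scope.
Local Notation normc := (@Normc.normc R).
Variables (I J : finType) (TI : cluster_tree I) (TJ : cluster_tree J).
Variable T : block_cluster_tree TI TJ.
Variables A AUH : 'M[C]_(#|I|, #|J|).
Hypotheses (I_gt0 : (0 < #|I|)%N) (J_gt0 : (0 < #|J|)%N).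

Lemma bilinear_adm_rows (E : 'M[C]_(#|I|, #|J|)) y x :
  (forall t s, t \in ct_nodes TI -> s \in ct_nodes TJ -> setX t s \in bct_inadm T ->
     block E t s = 0) ->
  (y^T *m E *m x) 0 0 =
  \sum_(t in adm_rows T) \sum_(s in row_clusters T t)
    ((subcol y t)^T *m block E t s *m subcol x s) 0 0.
Proof.
move=> E0; rewrite bilinear_enumE.
under [RHS]eq_bigr do under eq_bigr do rewrite block_bilinearE.
rewrite (sum_adm_rows T I_gt0 J_gt0 (fun i j => y (enum_rank i) 0 *
  E (enum_rank i) (enum_rank j) * x (enum_rank j) 0)).
rewrite pair_big /= (bigID (mem (cover (bct_adm T)))) /= [X in _ + X]big1 ?addr0 //.
(* The leaves cover all index pairs, so a pair outside the admissible blocks lies in an inadmissible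
   leaf, where [E] vanishes. *)
move=> [i j] /= nadm.
have : (i, j) \in cover (ct_leaves T) by rewrite ct_leaves_cover inE.
case/bigcupP => b bl ib.
have nb : b \notin bct_adm T by apply: contra nadm => ba; apply/bigcupP; exists b.
have bT : b \in ct_nodes T by move: bl; rewrite inE => /andP[].
have [t [s [tT sT Eb]]] := bct_nodes bT.
move: ib; rewrite Eb inE /= => /andP[it js].
have := E0 t s tT sT; rewrite inE -Eb nb bl => /(_ isT)/matrixP.
move=> /(_ (enum_rank_in it i) (enum_rank_in js j)); rewrite !mxE !enum_rankK_in //.
by move=> ->; rewrite mulr0 mul0r.
Qed.

(** By disjointness the left side is a partial sum of the nonnegative products |y_i|^2 |x_j|^2 over
    all of I x J. *)
Lemma sum_adm_norm2_le (y : 'cV[C]_#|I|) (x : 'cV[C]_#|J|) :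
  \sum_(t in adm_rows T) \sum_(s in row_clusters T t)
    norm2 (subcol y t) ^+ 2 * norm2 (subcol x s) ^+ 2 <= norm2 y ^+ 2 * norm2 x ^+ 2.
Proof.
under eq_bigr do under eq_bigr do rewrite !sqr_norm2_subcol big_distrlr /=.
rewrite (sum_adm_rows T I_gt0 J_gt0 (fun i j =>
  normc (y (enum_rank i) 0) ^+ 2 * normc (x (enum_rank j) 0) ^+ 2)).
rewrite !sqr_norm2_enum big_distrlr pair_big /=.
rewrite [leRHS](bigID (mem (cover (bct_adm T)))) /= lerDl.
by apply: sumr_ge0 => p _; rewrite mulr_ge0 ?sqr_ge0.
Qed.

Lemma normc_bilinear_adm_le y x (k : {set I} -> {set J} -> nat)
    (X : forall (t : {set I}) (s : {set J}), 'M[C]_(#|t|, k t s))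
    (Y : forall (t : {set I}) (s : {set J}), 'M[C]_(#|s|, k t s))
    (tolI : {set I} -> R) (tolJ : {set J} -> R)
    (lI : {set I} -> nat) (U : forall t : {set I}, 'M[C]_(#|t|, lI t))
    (lJ : {set J} -> nat) (V : forall s : {set J}, 'M[C]_(#|s|, lJ s)) :
  uniform_compression T A X Y tolI tolJ U V AUH ->
  normc ((y^T *m (A - AUH) *m x) 0 0) <=
  \sum_(t in adm_rows T) row_error T A (U t) * (norm2 (subcol y t) *
     Num.sqrt (\sum_(s in row_clusters T t) norm2 (subcol x s) ^+ 2)) +
  \sum_(s in adm_cols T) col_error T A (V s) * (norm2 (subcol x s) *
     Num.sqrt (\sum_(t in col_clusters T s) norm2 (subcol y t) ^+ 2)).
Proof.
case=> HU _ Hadm Hinadm; rewrite bilinear_adm_rows; last first.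
  by move=> t s tT sT ts; rewrite blockB Hinadm // subrr.
(* Adding and subtracting U_t U_t^* A_b separates the row projection error from the column
   projection error; the latter keeps a factor U_t U_t^* on its left. *)
have split_block t s : t \in adm_rows T -> s \in row_clusters T t ->
    block (A - AUH) t s = (block A t s - U t *m (U t)^t* *m block A t s) +
      U t *m (U t)^t* *m (block A t s - block A t s *m V s *m (V s)^t*).
  move=> tr /(row_clusters_adm_rows tr)[tT sT ts].
  by rewrite blockB Hadm //= mulmxBr !mulmxA addrA subrK.
under eq_bigr => t tr.
  under eq_bigr => s ts do rewrite split_block // mulmxDr mulmxDl mxE.
  rewrite big_split; over.
rewrite big_split /=.
apply: le_trans (le_normcD _ _) (lerD _ _).
  apply: le_trans (normc_sum _ _ _) (ler_sum _ _) => t _.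
  exact: row_projection_error_le.
(* The second part is regrouped by column clusters, so that each [V s] meets its own agglomeration
   matrix. *)
rewrite exchange_adm; apply: le_trans (normc_sum _ _ _) (ler_sum _ _) => s sc.
apply: col_projection_error_le => t /(col_clusters_adm_cols sc)[tT sT ts].
have /HU [? [? [? [_]]]] : t \in adm_rows T.
  by rewrite inE tT; apply/existsP; exists s; rewrite sT.
exact: leading_singular_vectors_orthonormal.
Qed.

End UniformCompression.

Theorem theorem5p1 (R : realType) (I J : finType)
    (TI : cluster_tree I) (TJ : cluster_tree J) (T : block_cluster_tree TI TJ)
    (A : 'M[R[i]]_(#|I|, #|J|))
    (k : {set I} -> {set J} -> nat)
    (X : forall (t : {set I}) (s : {set J}), 'M[R[i]]_(#|t|, k t s))
    (Y : forall (t : {set I}) (s : {set J}), 'M[R[i]]_(#|s|, k t s))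
    (HA : H_matrix T A X Y)
    (tolI : {set I} -> R) (tolJ : {set J} -> R)
    (lI : {set I} -> nat) (U : forall t : {set I}, 'M[R[i]]_(#|t|, lI t))
    (lJ : {set J} -> nat) (V : forall s : {set J}, 'M[R[i]]_(#|s|, lJ s))
    (AUH : 'M[R[i]]_(#|I|, #|J|))
    (HUH : uniform_compression T A X Y tolI tolJ U V AUH) :
  spectral_norm (A - AUH) <=
    Num.sqrt 2 * Num.sqrt (\sum_(t in adm_rows T) row_error T A (U t) ^+ 2 +
                           \sum_(s in adm_cols T) col_error T A (V s) ^+ 2)
  /\
  (forall eps : R, 0 < eps ->
     (forall t, t \in adm_rows T ->
        row_error T A (U t) =
          eps / 2 * Num.sqrt ((#|t| * #|row_far_field T t|)%:R / (#|I| * #|J|)%:R)) ->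
     (forall s, s \in adm_cols T ->
        col_error T A (V s) =
          eps / 2 * Num.sqrt ((#|s| * #|col_far_field T s|)%:R / (#|I| * #|J|)%:R)) ->
     spectral_norm (A - AUH) <= eps).
Proof.
(* If an index set is empty, the matrices have no entries and both bounds are trivial. Otherwise
   nodes are nonempty and |I| |J| can be divided by. *)
have [IJ0|] := boolP ((#|I| == 0%N) || (#|J| == 0%N)).
  have -> : spectral_norm (A - AUH) = 0.
    apply/le_anti; rewrite spectral_norm_ge0 andbT.
    apply: spectral_norm_le => // y x; rewrite mul0r.
    have -> : A - AUH = 0; last by rewrite mulmx0 mul0mx mxE Normc.normc0.
    apply/matrixP => i j.
    by case/orP: IJ0 => /eqP K0; [move: (ltn_ord i) | move: (ltn_ord j)]; rewrite {2}K0.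
  by split=> [|eps eps0 _ _]; rewrite ?mulr_ge0 ?sqrtr_ge0 ?ltW.
rewrite negb_or -!lt0n => /andP[I_gt0 J_gt0].
have sqr_sum_ge0 (K : finType) (P : pred K) (e : K -> R) : 0 <= \sum_(c | P c) e c ^+ 2.
  by apply: sumr_ge0 => c _; apply: sqr_ge0.
have bound : spectral_norm (A - AUH) <=
    Num.sqrt 2 * Num.sqrt (\sum_(t in adm_rows T) row_error T A (U t) ^+ 2 +
                           \sum_(s in adm_cols T) col_error T A (V s) ^+ 2).
  apply: spectral_norm_le => [|y x]; first by rewrite mulr_ge0 ?sqrtr_ge0.
  rewrite -{1}[y]trmxK.
  apply: le_trans (normc_bilinear_adm_le I_gt0 J_gt0 _ _ HUH) _.
  have N0 : 0 <= norm2 y^T * norm2 x by rewrite mulr_ge0 ?norm2_ge0.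
  have HN := sum_adm_norm2_le T I_gt0 J_gt0 y^T x.
  apply: le_trans (ler_wpM2r N0 (sqrtrD_le _ _)) => //; rewrite mulrDl; apply: lerD.
    apply: sum_mulr_sqrtr_le => //; rewrite exprMn.
    by under eq_bigr do rewrite mulr_sumr.
  apply: sum_mulr_sqrtr_le => //; rewrite exprMn.
  (* Regrouped by rows, the column sum becomes the same double sum over admissible blocks, so [HN]
     serves both families. *)
  apply: le_trans HN; rewrite exchange_adm; apply: ler_sum => s _.
  by rewrite mulr_sumr; under eq_bigr do rewrite mulrC.
split=> // eps eps0 HI HJ; apply: le_trans bound _.
have IJ_gt0 : 0 < (#|I| * #|J|)%:R :> R by rewrite ltr0n muln_gt0 I_gt0.
(* Each family contributes at most eps^2 / 4, the square of eps / 2; the two together under the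
   roots give sqrt 2 * sqrt (eps^2 / 2) = eps. *)
have scaled (K : finType) (P : pred K) (e : K -> R) (n : K -> nat) :
    (forall c, P c -> e c = eps / 2 * Num.sqrt ((n c)%:R / (#|I| * #|J|)%:R)) ->
    (\sum_(c | P c) n c <= #|I| * #|J|)%N ->
    \sum_(c | P c) e c ^+ 2 <= eps ^+ 2 / 4.
  move=> He Hn; rewrite (eq_bigr (fun c => eps ^+ 2 / 4 / (#|I| * #|J|)%:R * (n c)%:R)).
    rewrite -mulr_sumr -natr_sum -mulrA ler_piMr //.
      by rewrite divr_ge0 ?sqr_ge0.
    by rewrite mulrC ler_pdivrMr // mul1r ler_nat.
  move=> c /He ->; rewrite exprMn sqr_sqrtr ?divr_ge0 //.
  by move: (_ * _)%:R IJ_gt0 => q /lt0r_neq0 q0; field.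
rewrite -sqrtrM // -[leRHS](ger0_norm (ltW eps0)) -sqrtr_sqr; apply: ler_wsqrtr.
have := scaled _ _ _ _ HI (sum_row_far_field_card T I_gt0 J_gt0).
have := scaled _ _ _ _ HJ (sum_col_far_field_card T I_gt0 J_gt0).
lra.
Qed.
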